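(* Let $X$ be a finite alphabet with at least two letters and $k\ge2$. On $\mathcal{R}_k$ the relation $\leq_{CA}$ coincides with $\leq_{DA}$, and on $\mathcal{A}_k$ the relation $\leq_{CA}$ coincides with $\leq_{AA}$.
   Context: $X^\omega$ carries the Cantor topology; $\bar k=\{0,\dots,k-1\}$; a $k$-partition of $X^\omega$ is a function $X^\omega\to\bar k$. An automaton is $\mathcal{M}=(Q,f,in)$ with finite $Q$, $f:Q\times X\to Q$, initial state $in$; $f_{\mathcal M}(\xi)$ is the set of states visited infinitely often on input $\xi\in X^\omega$. Regular $\omega$-languages are those of the form $\{\xi:f_{\mathcal M}(\xi)\in\mathcal F\}$ for some automaton $\mathcal M$ and set $\mathcal F$ of state sets. $\mathcal M$ is aperiodic if $f(q,u^n)=q$ with $u$ nonempty and $n>0$ implies $f(q,u)=q$; aperiodic $\omega$-languages are those recognised this way with $\mathcal M$ aperiodic. $\mathcal R_k$ ($\mathcal A_k$) is the set of $k$-partitions all of whose components are regular (aperiodic). An asynchronous transducer is an automaton $\mathcal M$ together with an output function $g:Q\times X\to X^*$; on input $\xi$ it outputs the concatenation of $g(f(in,\xi\upharpoonright_n),\xi(n))$, $n<\omega$. A DA-function is a function $X^\omega\to X^\omega$ computed by an asynchronous transducer; an AA-function is one computed by an asynchronous transducer whose automaton is aperiodic. For $k$-partitions $A,B$: $A\le_{CA}B$ iff $A=B\circ h$ for some continuous $h:X^\omega\to X^\omega$; $A\le_{DA}B$ (resp. $A\le_{AA}B$) iff $A=B\circ h$ for some DA-function (resp. AA-function) $h$.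 *)

(* Defs.v *)
From mathcomp Require Import all_boot.
Set Implicit Arguments. Unset Strict Implicit. Unset Printing Implicit Defensive.

Definition word (X : Type) := nat -> X.

Definition agree (X : Type) (m : nat) (xi eta : word X) : Prop :=
  forall i, i < m -> xi i = eta i.

Definition cantor_continuous (X : Type) (h : word X -> word X) : Prop :=
  forall (xi : word X) (n : nat), exists m : nat,
    forall eta : word X, agree m xi eta -> agree n (h xi) (h eta).

Definition kpartition (X : Type) (k : nat) := word X -> 'I_k.

Definition run (X Q : Type) (f : Q -> X -> Q) (q : Q) (u : seq X) : Q := foldl f q u.

Definition state (X Q : Type) (f : Q -> X -> Q) (q0 : Q) (xi : word X) (n : nat) : Q :=
  run f q0 (mkseq xi n).

Definition inf_often (X Q : Type) (f : Q -> X -> Q) (q0 : Q) (xi : word X) (q : Q) : Prop :=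
  forall N, exists n, N <= n /\ state f q0 xi n = q.

Definition muller_accepts (X : Type) (Q : finType) (f : Q -> X -> Q) (q0 : Q)
    (F : {set {set Q}}) (xi : word X) : Prop :=
  exists S : {set Q}, S \in F /\ (forall q, q \in S <-> inf_often f q0 xi q).

Definition aperiodic (X Q : Type) (f : Q -> X -> Q) : Prop :=
  forall (q : Q) (u : seq X) (n : nat),
    0 < size u -> 0 < n -> run f q (flatten (nseq n u)) = q -> run f q u = q.

Definition regular_lang (X : Type) (L : word X -> Prop) : Prop :=
  exists (Q : finType) (f : Q -> X -> Q) (q0 : Q) (F : {set {set Q}}),
    forall xi, L xi <-> muller_accepts f q0 F xi.

Definition aperiodic_lang (X : Type) (L : word X -> Prop) : Prop :=
  exists (Q : finType) (f : Q -> X -> Q) (q0 : Q) (F : {set {set Q}}),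
    aperiodic f /\ forall xi, L xi <-> muller_accepts f q0 F xi.

Definition in_Rk (X : Type) (k : nat) (A : kpartition X k) : Prop :=
  forall i : 'I_k, regular_lang (fun xi => A xi = i).
Definition in_Ak (X : Type) (k : nat) (A : kpartition X k) : Prop :=
  forall i : 'I_k, aperiodic_lang (fun xi => A xi = i).

Definition trans_out (X Q : Type) (f : Q -> X -> Q) (g : Q -> X -> seq X) (q0 : Q)
    (xi : word X) (n : nat) : seq X :=
  flatten (mkseq (fun i => g (state f q0 xi i) (xi i)) n).

(* The transducer computes h: on every input the infinite concatenation of outputs
   is (infinite and) equal to h xi. *)
Definition computes (X Q : Type) (f : Q -> X -> Q) (g : Q -> X -> seq X) (q0 : Q)
    (h : word X -> word X) : Prop :=
  forall xi : word X,
    (forall m, exists n, m < size (trans_out f g q0 xi n)) /\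
    (forall n i, i < size (trans_out f g q0 xi n) ->
       nth (h xi i) (trans_out f g q0 xi n) i = h xi i).

Definition DA_function (X : Type) (h : word X -> word X) : Prop :=
  exists (Q : finType) (f : Q -> X -> Q) (g : Q -> X -> seq X) (q0 : Q),
    computes f g q0 h.

Definition AA_function (X : Type) (h : word X -> word X) : Prop :=
  exists (Q : finType) (f : Q -> X -> Q) (g : Q -> X -> seq X) (q0 : Q),
    aperiodic f /\ computes f g q0 h.

Definition le_CA (X : Type) (k : nat) (A B : kpartition X k) : Prop :=
  exists h : word X -> word X, cantor_continuous h /\ forall xi, A xi = B (h xi).
Definition le_DA (X : Type) (k : nat) (A B : kpartition X k) : Prop :=
  exists h : word X -> word X, DA_function h /\ forall xi, A xi = B (h xi).
Definition le_AA (X : Type) (k : nat) (A B : kpartition X k) : Prop :=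
  exists h : word X -> word X, AA_function h /\ forall xi, A xi = B (h xi).

(* Main.v *)
Require Import Defs.
From mathcomp Require Import all_boot.
From mathcomp Require Import boolp.
Set Implicit Arguments. Unset Strict Implicit. Unset Printing Implicit Defensive.

(* Product automata make [A xi] and [B eta] functions of the set of states that
   are visited infinitely often.  A cascade of one-bit flags detects, without
   destroying aperiodicity, for every set [S] of states, whether all of [S]
   recurs; so the automaton for [A] can be given a rank function for which one
   recurring state of minimal rank determines [A xi].

   Let [A = B o h] with [h] continuous.  For a component [C] of the graph of
   states of rank at least [i], extend inputs inside [C] until the set [T] of
   states that the run of B's automaton on the determined part of the output
   can still visit is minimal; then every state of [T] can be visited again and
   again.  Passing from [C] to a component of rank at least [i + 1] inside it,
   [T] can be replaced by a subset.  If some input recurs at [q] of minimal rank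
   [i] in [C], then some input makes its output visit precisely [T] infinitely
   often, so [T] carries the right value of [B].

   The transducer follows the automaton of [A], and whenever it enters a state
   [q] it moves its output run to a base point of the innermost set [T] attached
   to [q], inside the smallest attached set allowing that, and then tours [T].
   Its position depends only on [q] and on the outermost set, which changes only
   when the run leaves a component for good; hence aperiodicity is inherited. *)

(** * Recurring values of sequences in a finite set *)

Definition io (P : nat -> Prop) := forall N, exists n, N <= n /\ P n.

Lemma io_pigeonhole (T : finType) (s : nat -> T) (P : T -> Prop) :
  io (fun n => P (s n)) -> exists t, P t /\ io (fun n => s n = t).
Proof.
move=> ioP; apply: contrapT => noT.
have /choice[B HB] : forall t, exists N, forall n, N <= n -> P (s n) -> s n <> t.
  move=> t; apply: contrapT => noN; apply: noT; exists t; split.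
    apply: contrapT => nPt; apply: noN; exists 0 => n _ Pn snt.
    by apply: nPt; rewrite -snt.
  move=> N; apply: contrapT => non; apply: noN; exists N => n Nn _ snt.
  by apply: non; exists n.
have [n [Nn Pn]] := ioP (\max_t B t).
exact: (HB (s n) n (leq_trans (leq_bigmax _) Nn) Pn).
Qed.

(** If non-recurring values kept occurring, one of them would recur by pigeonhole. *)
Lemma eventually_io (T : finType) (s : nat -> T) :
  exists N, forall n, N <= n -> io (fun m => s m = s n).
Proof.
apply: contrapT => noN.
have [|t [nt iot]] := @io_pigeonhole T s (fun t => ~ io (fun m => s m = t)).
  move=> N; apply: contrapT => H; apply: noN; exists N => n Nn.
  by apply: contrapT => Hn; apply: H; exists n.
exact: nt.
Qed.

(** * Automata, their products and their infinity sets *)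

Section Automata.
Variable X : Type.

Record automaton := Automaton {
  astate :> finType;
  delta : astate -> X -> astate;
  start : astate }.

Definition trace (M : automaton) := state (@delta M) (start M).
Definition visited_io (M : automaton) := inf_often (@delta M) (start M).
Arguments visited_io M xi q : clear implicits.
Definition same_inf (M : automaton) (xi xi' : word X) :=
  forall q, visited_io M xi q <-> visited_io M xi' q.

Lemma run_cat (Q : Type) (f : Q -> X -> Q) q u v :
  run f q (u ++ v) = run f (run f q u) v.
Proof. exact: foldl_cat. Qed.

Lemma stateS (Q : Type) (f : Q -> X -> Q) q xi n :
  state f q xi n.+1 = f (state f q xi n) (xi n).
Proof. by rewrite /state mkseqS /run foldl_rcons. Qed.

Lemma run_nseq (Q : Type) (f : Q -> X -> Q) q u n :
  run f q (flatten (nseq n u)) = iter n (fun q => run f q u) q.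
Proof.
elim: n q => //= n IH q; rewrite run_cat IH.
by elim: n {IH} => //= n ->.
Qed.

Definition dprod_delta (I : finType) (M : I -> automaton)
    (q : {dffun forall i, M i}) (x : X) : {dffun forall i, M i} :=
  [ffun i : I => delta (q i) x].

Definition dprod (I : finType) (M : I -> automaton) :=
  @Automaton {dffun forall i, M i} (@dprod_delta I M) [ffun i : I => start (M i)].

Lemma run_dprod (I : finType) (M : I -> automaton) (q : dprod M) u i :
  run (@delta (dprod M)) q u i = run (@delta (M i)) (q i) u.
Proof. by elim: u q => //= x u IH q; rewrite IH ffunE. Qed.

Lemma trace_dprod (I : finType) (M : I -> automaton) xi n i :
  trace (dprod M) xi n i = trace (M i) xi n.
Proof. by rewrite /trace /state run_dprod ffunE. Qed.

Lemma aperiodic_dprod (I : finType) (M : I -> automaton) :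
  (forall i, aperiodic (@delta (M i))) -> aperiodic (@delta (dprod M)).
Proof.
move=> apM q u n u0 n0 qn; apply/ffunP => i; rewrite run_dprod.
by apply: (apM i _ u n) => //; rewrite -run_dprod qn.
Qed.

(** By pigeonhole, a recurring state of the factor is the coordinate of a recurring state of the
    product. *)
Lemma same_inf_dprod (I : finType) (M : I -> automaton) xi xi' i :
  same_inf (dprod M) xi xi' -> same_inf (M i) xi xi'.
Proof.
have H eta eta' : same_inf (dprod M) eta eta' -> forall q,
    visited_io (M i) eta q -> visited_io (M i) eta' q.
  move=> sM q ioq.
  have [p [pq iop]] : exists p : dprod M, p i = q /\ visited_io (dprod M) eta p.
    apply: (@io_pigeonhole _ (trace (dprod M) eta) (fun p => p i = q)) => N.
    by have [n [Nn <-]] := ioq N; exists n; rewrite trace_dprod.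
  move=> N; have [n [Nn np]] := (sM p).1 iop N; exists n; split=> //.
  by rewrite -pq -np; apply/esym/trace_dprod.
by move=> sM q; split; apply: H => // p; split => /sM.
Qed.

(* [ap] is [True] for the aperiodic half of the theorem and [False] for the
   regular one. *)
Definition aper (ap : Prop) (M : automaton) := ap -> aperiodic (@delta M).

Lemma inf_set (M : automaton) xi :
  exists S : {set M}, forall q, q \in S <-> visited_io M xi q.
Proof.
by exists [set q | `[< visited_io M xi q >]] => q; rewrite inE asboolE.
Qed.

(** * Deterministic Büchi conditions and ranked automata *)

Definition buchi (ap : Prop) (W : word X -> Prop) :=
  exists M : automaton, aper ap M /\ exists E : pred M,
    forall xi, W xi <-> io (fun n => E (trace M xi n)).

(* The flag records whether [E1] has occurred since the last occurrence of
   [E2]; it lags one step behind, so that the event "[E2] occurs while the flag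
   is up" is a property of the current state. *)
Lemma buchiI ap W1 W2 :
  buchi ap W1 -> buchi ap W2 -> buchi ap (fun xi => W1 xi /\ W2 xi).
Proof.
move=> [M1 [ap1 [E1 H1]]] [M2 [ap2 [E2 H2]]].
pose up (s : M1 * M2 * bool) := s.2 || E1 s.1.1.
pose d (s : M1 * M2 * bool) x :=
  (delta s.1.1 x, delta s.1.2 x, ~~ E2 s.1.2 && up s).
pose M := @Automaton _ d (start M1, start M2, false).
have run1 u s : (run d s u).1.1 = run (@delta M1) s.1.1 u.
  by elim: u s => //= x u IH s; rewrite IH.
have run2 u s : (run d s u).1.2 = run (@delta M2) s.1.2 u.
  by elim: u s => //= x u IH s; rewrite IH.
have mono u p b b' : (b ==> b') -> (run d (p, b) u).2 ==> (run d (p, b') u).2.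
  elim: u p b b' => //= x u IH p b b' bb'; apply: IH.
  by rewrite /up /=; case: (E2 p.2); case: b bb'; case: b'; case: (E1 p.1).
exists M; split=> [ap0 [p c] u n u0 n0|].
  rewrite run_nseq => rn.
  have pu b : (run d (p, b) u).1 = p.
    apply: injective_projections.
      rewrite run1; apply: (ap1 ap0 _ u n) => //.
      have -> : p.1 = (p, c).1.1 by [].
      by rewrite -run1 run_nseq rn.
    rewrite run2; apply: (ap2 ap0 _ u n) => //.
    have -> : p.2 = (p, c).1.2 by [].
    by rewrite -run2 run_nseq rn.
  (* The action of [u] on the flag. A monotone self-map of [bool] is constant or the identity, so it
     has no cycle of length two. *)
  pose phi b := (run d (p, b) u).2.
  have runE b : run d (p, b) u = (p, phi b) by apply: injective_projections; rewrite ?pu.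
  have phin : iter n phi c = c.
    suff: iter n (fun q => run d q u) (p, c) = (p, iter n phi c) by rewrite rn => -[].
    by elim: n {n0 rn} => //= n ->; rewrite runE.
  rewrite [LHS]runE; congr pair.
  have phim : phi false ==> phi true by exact: mono.
  have fixed m b : phi b = b -> iter m phi b = b by move=> pb; elim: m => //= m ->.
  case: n n0 {rn} phin => // n _; rewrite iterSr.
  have const b : (forall b', phi b' = b) -> iter n phi (phi c) = c -> phi c = c.
    by move=> pb; rewrite !pb fixed.
  move: phim; case pf: (phi false); case pt: (phi true) => // _.
  - by move=> /(const true); apply; case.
  - by move=> _; case: (c).
  - by move=> /(const false); apply; case.
exists (fun s => E2 s.1.2 && up s) => xi.
pose c n := (trace M xi n).2.
have t1 n : (trace M xi n).1.1 = trace M1 xi n by rewrite /trace /state run1.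
have t2 n : (trace M xi n).1.2 = trace M2 xi n by rewrite /trace /state run2.
have cS n : c n.+1 = ~~ E2 (trace M2 xi n) && (c n || E1 (trace M1 xi n)).
  by rewrite /c [trace M xi n.+1]stateS /= /up t1 t2.
have evE n : E2 (trace M xi n).1.2 && up (trace M xi n)
    = E2 (trace M2 xi n) && (c n || E1 (trace M1 xi n)) by rewrite /up t1 t2.
split=> [[/H1 io1 /H2 io2] N|ioE].
  (* The first [E2] at or after the [E1] at time [n1] finds the flag up, as nothing has lowered it
     in between. *)
  have [n1 [Nn1 e1]] := io1 N; have [n2 [n12 e2]] := io2 n1.
  have ex : exists n, (n1 <= n) && E2 (trace M2 xi n) by exists n2; rewrite n12.
  have [m /andP[n1m Em] minm] := ex_minnP ex.
  exists m; split; first exact: leq_trans n1m.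
  rewrite evE Em /=.
  have [->|ltm] := eqVneq m n1; first by rewrite e1 orbT.
  suff -> : c m by [].
  have {}ltm : n1 < m by rewrite ltn_neqAle eq_sym ltm.
  have noE j : n1 <= j -> j < m -> ~~ E2 (trace M2 xi j).
    by move=> n1j jm; apply/negP => Ej; move: (minm j); rewrite n1j Ej leqNgt jm => /(_ isT).
  elim: m ltm noE {n1m Em minm} => // m IH ltm noE; rewrite cS noE //=.
  move: ltm; rewrite ltnS leq_eqVlt => /orP[/eqP<-|ltm]; first by rewrite e1 orbT.
  by rewrite IH // => j n1j jm; apply: noE => //; rewrite ltnS ltnW.
have io2 : io (fun n => E2 (trace M2 xi n)).
  by move=> N; have [n [Nn]] := ioE N; rewrite evE => /andP[e2 _]; exists n.
split; first last; first exact/H2.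
apply/H1 => N; have [n [Nn e2]] := io2 N.
(* The [E2] at time [n] lowers the flag, so an event at [m > n] needs an [E1] after time [n]. *)
have [m [nm]] := ioE n.+1; rewrite evE => /andP[_ /orP[cm|e1]]; last first.
  by exists m; split=> //; apply: leq_trans Nn (leq_trans (leqnSn _) nm).
apply: contrapT => no1.
suff: ~~ c m by rewrite cm.
elim: m nm {cm} => // m IH; rewrite ltnS leq_eqVlt cS => /orP[/eqP<-|nm].
  by rewrite e2.
rewrite (negbTE (IH nm)) /= negb_and; apply/orP; right; apply/negP => e1.
by apply: no1; exists m; split=> //; apply: leq_trans Nn (ltnW nm).
Qed.

Lemma buchi_inf_contains ap (M : automaton) (s : seq M) : aper ap M ->
  buchi ap (fun xi => forall q, q \in s -> visited_io M xi q).
Proof.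
move=> apM; elim: s => [|q s [N [apN [E HE]]]].
  exists M; split=> //; exists xpredT => xi; split=> // _ n; exists n; by split.
have Bq : buchi ap (fun xi => visited_io M xi q).
  exists M; split=> //; exists (pred1 q) => xi.
  by split=> ioq n; have [m [nm /eqP e]] := ioq n; exists m.
have Bs : buchi ap (fun xi => forall q, q \in s -> visited_io M xi q).
  by exists N; split=> //; exists E.
have [K [apK [F HF]]] := buchiI Bq Bs; exists K; split=> //; exists F => xi.
rewrite -HF; split=> [H|[H1 H2] p]; last by rewrite inE => /orP[/eqP->|/H2].
by split=> [|p ps]; apply: H; rewrite inE ?eqxx ?ps ?orbT.
Qed.

(* Minimal rank among the infinitely visited states plays the role of a parity
   index: a state attaining it determines the value of [A]. *)
Definition min_rank_determines (T : Type) (A : word X -> T) (M : automaton) (p : M -> nat) :=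
  forall xi xi' q,
    (forall r, visited_io M xi r -> p q <= p r) ->
    (forall r, visited_io M xi' r -> p q <= p r) ->
    visited_io M xi q -> visited_io M xi' q -> A xi = A xi'.

(** [N] runs a Büchi automaton for every set [S] of states of [M], and [sel s] is a largest set
    whose event occurs in [s]. The largest set selected recurrently is the infinity set of [M];
    ranking by the size of the complement makes its rank minimal. *)
Lemma min_rank_automaton ap (T : Type) (A : word X -> T) (M : automaton) : aper ap M ->
  (forall xi xi', same_inf M xi xi' -> A xi = A xi') ->
  exists (N : automaton) (p : N -> nat), aper ap N /\ min_rank_determines A p.
Proof.
move=> apM HA.
have /choice[K HK] : forall S : {set M}, exists K : automaton, aper ap K /\
    exists E : pred K, forall xi,
      (forall q, q \in S -> visited_io M xi q) <-> io (fun n => E (trace K xi n)).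
  move=> S; have [K [apK [E HE]]] := buchi_inf_contains (enum S) apM.
  exists K; split=> //; exists E => xi; rewrite -HE.
  by split=> H q qS; apply: H; move: qS; rewrite mem_enum.
have {}HK S : (aper ap (K S) * {E : pred (K S) | forall xi,
    (forall q, q \in S -> visited_io M xi q) <-> io (fun n => E (trace (K S) xi n))})%type.
  by have [? /cid] := HK S.
pose E S := sval (HK S).2.
have HE (S : {set M}) xi : (forall q, q \in S -> visited_io M xi q) <->
    io (fun n => E S (trace (K S) xi n)) by exact: svalP (HK S).2 xi.
pose N := dprod K.
pose sel (s : N) := [arg max_(S > set0 | E S (s S) || (S == set0)) #|S|].
have selP (s : N) : (E (sel s) (s (sel s)) || (sel s == set0)) /\
    forall S, E S (s S) -> #|S| <= #|sel s|.
  rewrite /sel; case: arg_maxnP => [|S ES maxS]; first by rewrite eqxx orbT.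
  by split=> // S' ES'; apply: maxS; rewrite ES'.
exists N, (fun s => #|~: sel s|); split.
  by move=> ap0; apply: aperiodic_dprod => S; exact: (HK S).1.
have selE xi (q : N) : (forall r, visited_io N xi r -> #|~: sel q| <= #|~: sel r|) ->
    visited_io N xi q -> forall r, r \in sel q <-> visited_io M xi r.
  move=> minq ioq.
  have [S HS] := inf_set M xi.
  have subS : sel q \subset S.
    have [/orP[Eq|/eqP->] _] := selP q; last exact: sub0set.
    apply/subsetP => r rq; apply/HS; apply: (HE (sel q) xi).2 r rq => n.
    have [m [nm mq]] := ioq n; exists m; split=> //.
    by rewrite -trace_dprod; have -> : trace N xi m = q by [].
  have ioS : io (fun n => E S (trace N xi n S)).
    have /HE ioS : forall r, r \in S -> visited_io M xi r by move=> r /HS.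
    by move=> n; have [m [nm Em]] := ioS n; exists m; rewrite trace_dprod.
  have [r [Er ior]] := @io_pigeonhole N (trace N xi) (fun r => E S (r S)) ioS.
  have cardS : #|S| <= #|sel q|.
    apply: leq_trans ((selP r).2 _ Er) _.
    by have := minq r ior; rewrite -(leq_add2l #|sel q|) cardsC -(cardsC (sel r)) leq_add2r.
  have -> : sel q = S by apply/eqP; rewrite eqEcard subS.
  exact: HS.
move=> xi xi' q minq minq' ioq ioq'; apply: HA => r.
by rewrite -(selE xi q minq ioq) -(selE xi' q minq' ioq').
Qed.

Lemma partition_automaton ap k (A : kpartition X k) :
  (forall i, exists (Q : finType) (f : Q -> X -> Q) (q0 : Q) (F : {set {set Q}}),
    (ap -> aperiodic f) /\ forall xi, A xi = i <-> muller_accepts f q0 F xi) ->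
  exists M : automaton, aper ap M /\ forall xi xi', same_inf M xi xi' -> A xi = A xi'.
Proof.
move=> HA.
have /choice[M HM] : forall i, exists M : automaton, aper ap M /\
    forall xi xi', same_inf M xi xi' -> A xi = i -> A xi' = i.
  move=> i; have [Q [f [q0 [F [apf Hf]]]]] := HA i.
  exists (Automaton f q0); split=> // xi xi' same /Hf[S [SF HS]]; apply/Hf.
  by exists S; split=> // q; rewrite HS; apply: same.
exists (dprod M); split=> [ap0|xi xi' same].
  by apply: aperiodic_dprod => i; apply: (HM i).1.
by apply/esym/((HM (A xi)).2 xi xi') => //; apply: same_inf_dprod.
Qed.

End Automata.
Arguments visited_io {X} M xi q.

(** * Finite prefixes, limits of chains, and transducer outputs *)

Section Words.
Variables (X : Type) (x0 : X).

Definition extends (xi : word X) (u : seq X) := forall i, i < size u -> xi i = nth x0 u i.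
Definition pad (u : seq X) : word X := fun i => nth x0 u i.

Lemma extends_cat xi u v : extends xi (u ++ v) -> extends xi u.
Proof.
move=> H i iu; rewrite H ?size_cat ?(leq_trans iu) ?leq_addr //.
by rewrite nth_cat iu.
Qed.

Lemma mkseq_extends xi u : extends xi u -> mkseq xi (size u) = u.
Proof.
move=> H; apply: (@eq_from_nth _ x0); rewrite size_mkseq // => i iu.
by rewrite nth_mkseq // H.
Qed.

Lemma state_extends (Q : Type) (f : Q -> X -> Q) q xi u :
  extends xi u -> state f q xi (size u) = run f q u.
Proof. by move=> H; rewrite /state mkseq_extends. Qed.

Lemma state_agree (Q : Type) (f : Q -> X -> Q) q n xi eta :
  agree n xi eta -> state f q xi n = state f q eta n.
Proof.
elim: n => // n IH H; rewrite !stateS IH ?H // => i /ltnW.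
exact: H.
Qed.

Lemma agreeW n m (xi eta : word X) : m <= n -> agree n xi eta -> agree m xi eta.
Proof. by move=> mn H i im; apply: H; apply: leq_trans mn. Qed.

Lemma chain_cat (u : nat -> seq X) :
  (forall n, exists w, u n.+1 = u n ++ w) ->
  forall n m, n <= m -> exists w, u m = u n ++ w.
Proof.
move=> uS n m /subnKC <-; elim: (m - n) => [|k [w IH]].
  by exists [::]; rewrite addn0 cats0.
have [w' E] := uS (n + k); exists (w ++ w').
by rewrite addnS E IH catA.
Qed.

Lemma chain_limit (u : nat -> seq X) :
  (forall n, exists w, u n.+1 = u n ++ w) -> (forall n, exists k, n < size (u k)) ->
  exists xi, forall k, extends xi (u k).
Proof.
move=> uS /choice[K HK].
(* [K i] is a stage at which letter [i] is already present; any two stages are comparable and so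
   agree on it. *)
exists (fun i => nth x0 (u (K i)) i) => k i ik.
have [kK|/ltnW Kk] := leqP k (K i).
  by have [w ->] := chain_cat uS kK; rewrite nth_cat ik.
by have [w ->] := chain_cat uS Kk; rewrite nth_cat HK.
Qed.

Lemma mem_scanl (Q : eqType) (f : Q -> X -> Q) q w t :
  t \in scanl f q w -> exists j, [/\ 0 < j, j <= size w & run f q (take j w) = t].
Proof.
elim: w q => //= x w IH q; rewrite inE => /orP[/eqP->|/IH[j [j0 jw <-]]].
  by exists 1; split=> //=; rewrite take0.
by exists j.+1; split.
Qed.

Lemma run_take_scanl (Q : eqType) (f : Q -> X -> Q) q w j :
  0 < j -> j <= size w -> run f q (take j w) \in scanl f q w.
Proof.
elim: w q j => [|x w IH] q [|[|j]] //= _ jw; first by rewrite take0 inE eqxx.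
by rewrite inE IH ?orbT.
Qed.

Lemma run_scanl (Q : eqType) (f : Q -> X -> Q) q w :
  0 < size w -> run f q w \in scanl f q w.
Proof. by move=> w0; rewrite -{1}[w]take_size run_take_scanl. Qed.

(* The initial state [q] itself is not required to belong to [C]. *)
Definition stays (Q : finType) (f : Q -> X -> Q) (C : {set Q}) q v :=
  all (mem C) (scanl f q v).

Lemma stays_cat (Q : finType) (f : Q -> X -> Q) C q u v :
  stays f C q (u ++ v) = stays f C q u && stays f C (run f q u) v.
Proof. by rewrite /stays scanl_cat all_cat. Qed.

Lemma staysS (Q : finType) (f : Q -> X -> Q) (C D : {set Q}) q v :
  C \subset D -> stays f C q v -> stays f D q v.
Proof. by move=> /subsetP CD; apply: sub_all => t; apply: CD. Qed.

Lemma run_stays (Q : finType) (f : Q -> X -> Q) (C : {set Q}) q v :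
  q \in C -> stays f C q v -> run f q v \in C.
Proof.
case: v => // x v _ /allP H; apply: H; exact: run_scanl.
Qed.

Lemma stays_flatten (Q : finType) (f : Q -> X -> Q) (C : {set Q}) q v n :
  run f q v = q -> stays f C q v ->
  run f q (flatten (nseq n v)) = q /\ stays f C q (flatten (nseq n v)).
Proof.
move=> rv sv; elim: n => //= n [rn sn].
by rewrite run_cat stays_cat rv sv.
Qed.

Lemma trans_outS (Q : Type) (f : Q -> X -> Q) (g : Q -> X -> seq X) q xi n :
  trans_out f g q xi n.+1 = trans_out f g q xi n ++ g (state f q xi n) (xi n).
Proof. by rewrite /trans_out mkseqS flatten_rcons. Qed.

(** Each finite part of the output is written after finitely many steps, which see only a finite
    prefix of the input. *)
Lemma computes_continuous (Q : Type) (f : Q -> X -> Q) g q h :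
  computes f g q h -> cantor_continuous h.
Proof.
move=> H xi n; have [inf _] := H xi; have [m nm] := inf n.
exists m => eta ag i lin.
have out : trans_out f g q xi m = trans_out f g q eta m.
  elim: m ag {nm} => // m IH ag; rewrite !trans_outS IH; last first.
    by move=> j jm; apply: ag; apply: ltnW.
  rewrite ag //; congr (_ ++ g _ _); apply: state_agree.
  exact: agreeW ag.
have im : i < size (trans_out f g q xi m) by apply: ltn_trans nm.
rewrite -((H xi).2 m i im) -((H eta).2 m i) -?out //.
exact: set_nth_default.
Qed.

Lemma trans_out_computes (Q : Type) (f : Q -> X -> Q) (g : Q -> X -> seq X) q :
  (forall xi m, exists n, m < size (trans_out f g q xi n)) ->
  exists h, computes f g q h /\
    forall xi n, extends (h xi) (trans_out f g q xi n).
Proof.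
move=> H.
have /choice[h Hh] : forall xi, exists eta, forall n, extends eta (trans_out f g q xi n).
  move=> xi; apply: chain_limit => // n.
  by eexists; rewrite trans_outS.
exists h; split=> // xi; split=> // n i ni.
by rewrite (set_nth_default x0) // (Hh xi n).
Qed.

End Words.

(** * Strongly connected components at each rank level *)

Section Components.
Variables (X : finType) (M : automaton X) (p : M -> nat).

(* [scc i q] is the strongly connected component of [q] in the transition graph
   restricted to the states of rank at least [i]. *)
Definition edge (i : nat) : rel M :=
  [rel q r | [&& i <= p q, i <= p r & [exists x, delta q x == r]]].
Definition scc i q := [set r | connect (edge i) q r && connect (edge i) r q].
(** As [connect] is reflexive, a component may be a single state without a loop; this is excluded
    here. *)
Definition recurrent i q := exists v,
  [/\ 0 < size v, run (@delta _ M) q v = q & stays (@delta _ M) (scc i q) q v].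

Lemma scc_refl i q : q \in scc i q.
Proof. by rewrite inE connect0. Qed.

Lemma scc_eq i q r : r \in scc i q -> scc i r = scc i q.
Proof.
rewrite inE => /andP[qr rq]; apply/setP => s; rewrite !inE.
apply/andP/andP => -[H1 H2].
  by split; [apply: connect_trans H1 | apply: connect_trans rq].
by split; [apply: connect_trans H1 | apply: connect_trans qr].
Qed.

Lemma scc_rank i q r : i <= p q -> r \in scc i q -> i <= p r.
Proof.
move=> iq; rewrite inE => /andP[/connectP[s]].
case/lastP: s => [_ -> //|s z]; rewrite rcons_path last_rcons => /andP[_].
by move=> /and3P[_ iz _] -> _.
Qed.

Lemma scc_subset i j q : i <= j -> scc j q \subset scc i q.
Proof.
move=> ij; have sub : subrel (edge j) (connect (edge i)).
  move=> s t /and3P[js jt e]; apply: connect1.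
  by rewrite /edge /= (leq_trans ij js) (leq_trans ij jt).
by apply/subsetP => r; rewrite !inE => /andP[/(connect_sub sub) -> /(connect_sub sub)].
Qed.

Lemma scc_path i q r : r \in scc i q ->
  exists v, run (@delta _ M) q v = r /\ stays (@delta _ M) (scc i q) q v.
Proof.
rewrite inE => /andP[/connectP[s]].
(* Generalised to suffixes of the path: each of their states is reachable from [q] and leads back to
   [q] through the end of the path. *)
suff H q1 : connect (edge i) q q1 -> path (edge i) q1 s ->
    connect (edge i) (last q1 s) q ->
    exists v, run (@delta _ M) q1 v = last q1 s /\ stays (@delta _ M) (scc i q) q1 v.
  by move=> ps -> /H; apply.
elim: s q1 => [|z s IH] q1 qq1 /=; first by exists [::].
move=> /andP[e ps] zq.
have qz : connect (edge i) q z by apply: connect_trans qq1 (connect1 e).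
have [v [rv sv]] := IH z qz ps zq.
have /and3P[_ _ /existsP[x /eqP ex]] := e.
exists (x :: v); rewrite /stays /= ex rv; split=> //; apply/andP; split=> //.
rewrite /= inE qz; apply: connect_trans zq; apply/connectP; exists s => //.
Qed.

Lemma connect_trace i xi n m : (forall k, n <= k -> k <= m -> i <= p (trace M xi k)) ->
  n <= m -> connect (edge i) (trace M xi n) (trace M xi m).
Proof.
move=> H /subnKC E; rewrite -E in H *; elim: (m - n) H {E} => [|k IH] H.
  by rewrite addn0.
apply: (@connect_trans _ _ (trace M xi (n + k))).
  by apply: IH => j nj jk; apply: H; rewrite // addnS ltnW.
rewrite addnS; apply: connect1; rewrite /edge /= !H ?addnS ?leq_addr ?leqnSn //=; last first.
  by rewrite (leq_trans (leq_addr k n)).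
by apply/existsP; exists (xi (n + k)); rewrite [trace M xi (n + k).+1]stateS.
Qed.

End Components.

(** * Input prefixes with determined output, and live sets of output states *)

Section Configurations.
Variables (X : finType) (x0 : X) (M N : automaton X) (p : M -> nat).
Variables (h : word X -> word X) (hcont : cantor_continuous h).

(* A configuration [(u, m)] is an input prefix together with a number of output
   letters of [h] that this prefix already determines. *)
Notation config := (seq X * nat)%type.
Definition determined (a : config) :=
  forall xi, extends x0 xi a.1 -> agree a.2 (h (pad x0 a.1)) (h xi).
Definition in_state (a : config) := run (@delta _ M) (start M) a.1.
Definition out_state (a : config) := state (@delta _ N) (start N) (h (pad x0 a.1)) a.2.

Definition evolves (C : {set M}) (a b : config) := exists v,
  [/\ b.1 = a.1 ++ v, stays (@delta _ M) C (in_state a) v, a.2 <= b.2 & determined b].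

Lemma extends_pad u v : extends x0 (pad x0 (u ++ v)) u.
Proof. exact: (@extends_cat _ _ _ _ v). Qed.

Lemma determined_cat u v m m' : determined (u, m) -> m' <= m -> determined (u ++ v, m').
Proof.
move=> H m'm xi /= exv i im'; have exi := extends_cat exv.
have im := leq_trans im' m'm.
by rewrite -(H _ (@extends_pad u v)) // (H xi).
Qed.

Lemma out_state_extends u m xi i : determined (u, m) -> extends x0 xi u -> i <= m ->
  state (@delta _ N) (start N) (h xi) i = out_state (u, i).
Proof.
move=> H exi im; apply/esym/state_agree; apply: agreeW im _; exact: H.
Qed.

Lemma evolves_refl C a : determined a -> evolves C a a.
Proof. by exists [::]; rewrite cats0. Qed.

Lemma evolves_trans C a b c : evolves C a b -> evolves C b c -> evolves C a c.
Proof.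
move=> [v [bv sv ab _]] [w [cw sw bc dc]]; exists (v ++ w).
rewrite catA -bv cw stays_cat sv /= (leq_trans ab bc); split=> //.
by move: sw; rewrite /in_state bv run_cat.
Qed.

Lemma evolvesS (C D : {set M}) a b : C \subset D -> evolves C a b -> evolves D a b.
Proof. by move=> CD [v [? /(staysS CD) ? ? ?]]; exists v. Qed.

Lemma evolves_input C a v : determined a -> stays (@delta _ M) C (in_state a) v ->
  evolves C a (a.1 ++ v, a.2).
Proof.
by case: a => u m det sv; exists v; split=> //; apply: determined_cat det _.
Qed.

Lemma evolves_determined C a b : evolves C a b -> determined b.
Proof. by case=> v []. Qed.

Lemma in_state_evolves (C : {set M}) a b : in_state a \in C -> evolves C a b -> in_state b \in C.
Proof.
by move=> aC [v [bv sv _ _]]; rewrite /in_state bv run_cat run_stays.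
Qed.

(** [w] consists of the output letters from position [a.2] to [b.2]; intermediate configurations
    combine the whole input [b.1] with fewer output letters. *)
Lemma evolves_out_word C a b : determined a -> evolves C a b ->
  exists w, [/\ size w = b.2 - a.2, run (@delta _ N) (out_state a) w = out_state b &
    forall s, s \in scanl (@delta _ N) (out_state a) w ->
      exists c, evolves C a c /\ out_state c = s].
Proof.
move=> da [v [bv sv ab db]].
have H k : a.2 + k <= b.2 -> exists w, [/\ size w = k,
    run (@delta _ N) (out_state a) w = out_state (b.1, a.2 + k) &
    forall s, s \in scanl (@delta _ N) (out_state a) w ->
      exists c, evolves C a c /\ out_state c = s].
  elim: k => [|k IH] kb.
    exists [::]; split=> //=; rewrite addn0; case: (a) da bv => u m da /= ->.
    by rewrite -(out_state_extends da (@extends_pad u v)).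
  rewrite addnS in kb; have [w [wk rw sw]] := IH (ltnW kb).
  have rS : run (@delta _ N) (out_state a) (rcons w (h (pad x0 b.1) (a.2 + k)))
      = out_state (b.1, a.2 + k.+1).
    by rewrite /run foldl_rcons -/(run _ _ _) rw addnS /out_state stateS.
  exists (rcons w (h (pad x0 b.1) (a.2 + k))); split=> //.
    by rewrite size_rcons wk.
  move=> s; rewrite scanl_rcons mem_rcons inE => /orP[/eqP ->|/sw //].
  exists (b.1, a.2 + k.+1); split=> //; exists v; split=> //=.
    exact: leq_addr.
  move=> xi exi; apply: agreeW (db xi exi); by rewrite addnS.
have [|w [wk rw sw]] := H (b.2 - a.2); first by rewrite subnKC.
by exists w; split=> //; rewrite rw subnKC //; case: (b).
Qed.

(* From [a] on, as long as the input stays in [C], the output run stays in [T]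
   and can always be continued so as to visit any prescribed state of [T]. *)
Definition live (C : {set M}) (a : config) (T : {set N}) :=
  [/\ determined a, in_state a \in C &
    forall b, evolves C a b -> out_state b \in T /\
      forall t, t \in T -> exists c, evolves C b c /\ out_state c = t].
Definition liveable C T := exists a, live C a T.

Lemma live_evolves C a b T : live C a T -> evolves C a b -> live C b T.
Proof.
move=> [da aC H] ab; split; first exact: evolves_determined ab.
  exact: in_state_evolves ab.
by move=> c /(evolves_trans ab)/H.
Qed.

(** Induction on the size of [G]: if some [t] in [G] becomes unreachable after some evolution,
    continue from there with [G :\ t]. *)
Lemma live_ex (C : {set M}) a (G : {set N}) : determined a -> in_state a \in C ->
  (forall b, evolves C a b -> out_state b \in G) ->
  exists b T, [/\ evolves C a b, live C b T & T \subset G].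
Proof.
have [n] := ubnP #|G|; elim: n => // n IH in G a *; rewrite ltnS => Gn da aC aG.
have [H|/existsNP[b /not_implyP[ab]]] :=
  EM (forall b, evolves C a b -> forall t, t \in G -> exists c, evolves C b c /\ out_state c = t).
  exists a, G; split=> //; first exact: evolves_refl.
  by split=> // b ab; split; [apply: aG | apply: H].
move=> /existsNP[t /not_implyP[tG no]].
have [||||b' [T [bb' lT TG]]] := IH (G :\ t) b.
- by rewrite (cardsD1 t) tG in Gn.
- exact: evolves_determined ab.
- exact: in_state_evolves ab.
- move=> c bc; rewrite !inE (aG c (evolves_trans ab bc)) andbT.
  by apply/eqP => ct; apply: no; exists c.
exists b', T; split=> //; first exact: evolves_trans bb'.
by apply: subset_trans TG _; apply: subsetDl.
Qed.

Lemma liveable_connected C T : liveable C T -> forall s t, s \in T -> t \in T ->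
  exists w, run (@delta _ N) s w = t /\ stays (@delta _ N) T s w.
Proof.
move=> [a [da aC H]] s t sT tT.
have [_ /(_ s sT)[b [ab <-]]] := H a (evolves_refl C da).
have [_ /(_ t tT)[c [bc <-]]] := H b ab.
have [w [_ rw sw]] := evolves_out_word (evolves_determined ab) bc.
exists w; split=> //; apply/allP => r /sw[e [be <-]].
by have [] := H e (evolves_trans ab be).
Qed.

Lemma liveable_inhabited C T : liveable C T -> exists t, t \in T.
Proof.
by move=> [a [da aC H]]; exists (out_state a); have [] := H a (evolves_refl C da).
Qed.

(** Move to [q] inside the larger component; evolutions in the smaller one still keep the output in
    [T], and [live_ex] shrinks [T]. *)
Lemma liveable_sccS i q T : liveable (scc p i q) T -> i < p q ->
  exists T', liveable (scc p i.+1 q) T' /\ T' \subset T.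
Proof.
move=> [a [da aC H]] iq.
have [v [rv sv]] : exists v, run (@delta _ M) (in_state a) v = q /\
    stays (@delta _ M) (scc p i q) (in_state a) v.
  by rewrite -(scc_eq aC); apply: scc_path; rewrite (scc_eq aC) scc_refl.
have ab := evolves_input da sv.
have sub := scc_subset p q (leqnSn i).
have [|||c [T' [bc lT' TT']]] := @live_ex (scc p i.+1 q) (a.1 ++ v, a.2) T.
- exact: evolves_determined ab.
- by rewrite /in_state run_cat -/(in_state a) rv scc_refl.
- by move=> c /(evolvesS sub)/(evolves_trans ab)/H[].
by exists T'; split=> //; exists c.
Qed.

(* Continuity along the input that loops at [q] forces further output. *)
Lemma evolves_progress i q a : determined a -> in_state a \in scc p i q ->
  recurrent p i q -> exists b, [/\ evolves (scc p i q) a b, a.2 < b.2,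
    size a.1 < size b.1 & in_state b = q].
Proof.
move=> da aC [v [v0 rv sv]].
have [w [rw sw]] : exists w, run (@delta _ M) (in_state a) w = q /\
    stays (@delta _ M) (scc p i q) (in_state a) w.
  by rewrite -(scc_eq aC); apply: scc_path; rewrite (scc_eq aC) scc_refl.
pose u k := (a.1 ++ w) ++ flatten (nseq k v).
have sizeu k : k <= size (u k).
  rewrite size_cat; apply: leq_trans (leq_addl _ _).
  elim: k => //= k IH; rewrite size_cat; apply: leq_trans (leq_add v0 IH) _ => //.
have [|n|xi exi] := @chain_limit _ x0 u.
- move=> n; exists v; rewrite /u -[RHS]catA; congr (_ ++ _).
  by rewrite -addn1 nseqD flatten_cat /= cats0.
- by exists n.+1; apply: sizeu.
have [m Hm] := hcont xi a.2.+1.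
(* Enough loops to cover the modulus of continuity [m] and to make the input strictly longer than
   [a.1]. *)
pose k := maxn m (size a.1).+1.
have sk : size a.1 < size (u k) by apply: leq_trans (sizeu k); rewrite leq_max leqnn orbT.
have agr eta : extends x0 eta (u k) -> agree m xi eta.
  move=> ee j jm; have jk : j < size (u k).
    by apply: leq_trans (sizeu k); apply: leq_trans jm (leq_maxl _ _).
  by rewrite ee // (exi k).
have [rf sf] := stays_flatten k rv sv.
exists (u k, a.2.+1); split=> //; last first.
  by rewrite /in_state !run_cat -/(in_state a) rw.
exists (w ++ flatten (nseq k v)); split; rewrite //=.
- by rewrite /u catA.
- by rewrite stays_cat sw rw.
move=> eta ee j jn; rewrite -(Hm _ (agr _ ee)) //.
by rewrite -(Hm (pad x0 (u k)) (agr _ _)).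
Qed.

(** One round of a play. Each visit occurs beyond output position [a.2], so that iterated rounds
    give infinitely many visits. *)
Lemma evolves_round i q T a (l : seq N) : live (scc p i q) a T -> recurrent p i q ->
  {subset l <= T} -> exists b, [/\ evolves (scc p i q) a b, a.2 < b.2,
    size a.1 < size b.1, in_state b = q & forall t, t \in l -> exists c,
      [/\ evolves (scc p i q) a c, evolves (scc p i q) c b, a.2 < c.2 & out_state c = t]].
Proof.
move=> lT rec; elim: l => [|t l IH] lsub.
  have [da aC _] := lT.
  by have [b [? ? ? ?]] := evolves_progress da aC rec; exists b; split.
have [|b [ab lab sab qb vb]] := IH; first by move=> s sl; apply: lsub; rewrite inE sl orbT.
have lb := live_evolves lT ab.
have [db bC H] := lb.
have [_ /(_ t)[|c [bc ct]]] := H b (evolves_refl _ db); first by apply: lsub; rewrite inE eqxx.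
have [dc cC _] := live_evolves lb bc.
have [e [ce lce sce qe]] := evolves_progress dc cC rec.
have bc2 : b.2 <= c.2 by case: bc => ? [].
have ac : a.2 < c.2 := leq_trans lab bc2.
have bcs : size b.1 <= size c.1 by case: bc => ? [-> *]; rewrite size_cat leq_addr.
exists e; split=> //.
- exact: evolves_trans (evolves_trans ab bc) ce.
- exact: ltn_trans lce.
- exact: ltn_trans (leq_trans sab bcs) sce.
move=> s; rewrite inE => /orP[/eqP ->|/vb[f [af fb lf fs]]].
  by exists c; split=> //; apply: evolves_trans bc.
by exists f; split=> //; apply: evolves_trans (evolves_trans bc ce).
Qed.

(** The limit of rounds through all of [T]: each round returns to [q], and liveness keeps the output
    run in [T]. *)
Lemma live_play q T : liveable (scc p (p q) q) T -> recurrent p (p q) q ->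
  exists xi, [/\ visited_io M xi q, forall r, visited_io M xi r -> p q <= p r &
    forall t, visited_io N (h xi) t <-> t \in T].
Proof.
set C := scc p (p q) q => -[a lT] rec; have [da aC aT] := lT.
have /choice[next Hnext] : forall b, exists b', evolves C a b ->
    [/\ evolves C b b', b.2 < b'.2, size b.1 < size b'.1, in_state b' = q &
      forall t, t \in T -> exists c,
        [/\ evolves C b c, evolves C c b', b.2 < c.2 & out_state c = t]].
  move=> b; have [ab|nab] := EM (evolves C a b); last by exists b.
  have [|b' [? ? ? ? Hb']] := evolves_round (live_evolves lT ab) rec (l := enum T).
    by move=> t; rewrite mem_enum.
  by exists b' => _; split=> // t tT; apply: Hb'; rewrite mem_enum.
pose b n := iter n next a.
have ab n : evolves C a (b n).
  elim: n => [|n IH]; first exact: evolves_refl.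
  by apply: evolves_trans (IH) _; have [] := Hnext _ IH.
have bS n := Hnext _ (ab n).
have size1 n : n <= size (b n).1.
  by elim: n => // n IH; have [_ _ sb _ _] := bS n; apply: leq_ltn_trans IH sb.
have size2 n : n <= (b n).2.
  by elim: n => // n IH; have [_ sb _ _ _] := bS n; apply: leq_ltn_trans IH sb.
have [|n|xi exi] := @chain_limit _ x0 (fun n => (b n).1).
- by move=> n; have [[v [bv _ _ _]] _ _ _ _] := bS n; exists v.
- by exists n.+1; apply: size1.
have trE n : trace M xi (size (b n).1) = in_state (b n).
  exact: state_extends (exi n).
exists xi; split.
- move=> n; exists (size (b n.+1).1); split; first by apply: leq_trans (size1 _).
  by have [_ _ _ bq _] := bS n; exact: etrans (trE n.+1) bq.
- move=> r /(_ (size a.1))[m [am mr]].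
  apply: (scc_rank (leqnn (p q))); rewrite -/C.
  have [v [bv sv _ _]] := ab m.
  have ext : extends x0 xi (a.1 ++ take (m - size a.1) v).
    apply: (@extends_cat _ _ _ _ (drop (m - size a.1) v)).
    by rewrite -catA cat_take_drop -bv.
  have sz : size (a.1 ++ take (m - size a.1) v) = m.
    rewrite size_cat size_take_min (minn_idPl _) ?subnKC //.
    by rewrite leq_subLR -size_cat -bv.
  rewrite -mr -[in state _ _ _ m]sz (state_extends _ _ ext) run_cat.
  apply: run_stays => //; move: sv.
  by rewrite -{1}(cat_take_drop (m - size a.1) v) stays_cat => /andP[].
move=> t; split=> [/(_ a.2)[m [am mt]]|tT n].
  have [v [bv sv _ db]] := ab m.
  have dbm : determined ((b m).1, m).
    by move=> eta ee; apply: agreeW (db eta ee).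
  have [|mT _] := aT ((b m).1, m); first by exists v.
  by rewrite -mt (out_state_extends dbm (exi m)).
have [_ _ _ _ /(_ t tT)[c [bc [v [cv _ _ _]] lc ct]]] := bS n.
exists c.2; split; first exact: leq_trans (size2 n) (ltnW lc).
have dc : determined (c.1, c.2) by move: (evolves_determined bc); case: (c).
have ec : extends x0 xi c.1 by apply: (@extends_cat _ _ _ _ v); rewrite -cv; exact: exi n.+1.
by rewrite -ct (out_state_extends dc ec) //; case: (c).
Qed.

End Configurations.

(** * The transducer: memory, commitments and output words *)

Section Strategy.
Variables (X : finType) (x0 : X) (M N : automaton X) (p : M -> nat).
Variables (h : word X -> word X) (hcont : cantor_continuous h).

Notation runM := (run (@delta _ M)).
Notation runN := (run (@delta _ N)).
Notation staysM := (stays (@delta _ M)).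
Notation staysN := (stays (@delta _ N)).
Notation lv := (@liveable X x0 M N h).

(** The choice depends only on the component and the outer set, so all states of a component share
    it. Without a candidate its value is arbitrary. *)
Lemma narrow_ex (CT : {set M} * {set N}) : exists T' : {set N},
  (exists T'', lv CT.1 T'' /\ T'' \subset CT.2) -> lv CT.1 T' /\ T' \subset CT.2.
Proof.
have [[T' H]|no] := EM (exists T'', lv CT.1 T'' /\ T'' \subset CT.2); first by exists T'.
by exists set0.
Qed.
Definition narrow C T := projT1 (boolp.choice narrow_ex) (C, T).

Fixpoint nested (o : {set N}) (q : M) (i : nat) : {set N} :=
  if i is i'.+1 then narrow (scc p i q) (nested o q i') else o.

Definition reaches (r : N) (T : {set N}) := exists t w, t \in T /\ runN r w = t.

Lemma renew_ex (rq : N * M) : exists T : {set N},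
  (exists T', lv (scc p 0 rq.2) T' /\ reaches rq.1 T') ->
  lv (scc p 0 rq.2) T /\ reaches rq.1 T.
Proof.
have [[T H]|no] := EM (exists T', lv (scc p 0 rq.2) T' /\ reaches rq.1 T'); first by exists T.
by exists set0.
Qed.
Definition renew r q := projT1 (boolp.choice renew_ex) (r, q).

Definition base (T : {set N}) : N := odflt (start N) [pick t in T].

(* The memory of the transducer: the state of [M] and, from the first input
   letter on, the set of states of [N] to which the output run is committed as
   long as the input stays in its present component. *)
Notation memory := (M * option {set N})%type.
Definition position (s : memory) : N :=
  if s.2 is Some o then base (nested o s.1 (p s.1)) else start N.
Definition commit (s : memory) (x : X) : {set N} :=
  let q := delta s.1 x in
  if s.2 is Some o then (if q \in scc p 0 s.1 then o else renew (position s) q)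
  else renew (position s) q.
Definition step (s : memory) (x : X) : memory := (delta s.1 x, Some (commit s x)).
Definition sound (s : memory) :=
  if s.2 is Some o then lv (scc p 0 s.1) o else s.1 = start M.

Lemma nestedS o q i : lv (scc p 0 q) o -> i < p q ->
  lv (scc p i q) (nested o q i) -> lv (scc p i.+1 q) (nested o q i.+1) /\
    nested o q i.+1 \subset nested o q i.
Proof.
move=> lo iq li; apply: (projT2 (boolp.choice narrow_ex) (_, _)).
exact: liveable_sccS li iq.
Qed.

Lemma nested_live o q i : lv (scc p 0 q) o -> i <= p q -> lv (scc p i q) (nested o q i).
Proof.
move=> lo; elim: i => // i IH iq.
by have [] := nestedS lo iq (IH (ltnW iq)).
Qed.

Lemma nested_subset o q i j : lv (scc p 0 q) o -> i <= j -> j <= p q ->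
  nested o q j \subset nested o q i.
Proof.
move=> lo /subnKC <-; elim: (j - i) => [|k IH]; first by rewrite addn0.
rewrite addnS => kq; apply: subset_trans (IH (ltnW kq)).
by have [] := nestedS lo kq (nested_live lo (ltnW kq)).
Qed.

(** [narrow] sees only components, and [q] and [r] share theirs up to level [J]. *)
Lemma nested_scc o q r J i : r \in scc p J q -> i <= J -> nested o q i = nested o r i.
Proof.
move=> rq; elim: i => // i IH iJ /=.
rewrite IH ?(ltnW iJ) //; congr narrow; apply/esym/scc_eq.
exact: (subsetP (scc_subset p q iJ)).
Qed.

Lemma base_mem C T : lv C T -> base T \in T.
Proof.
move=> /liveable_inhabited[t tT]; rewrite /base; case: pickP => //= /(_ t).
by rewrite tT.
Qed.

Lemma position_mem q o i : lv (scc p 0 q) o -> i <= p q ->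
  position (q, Some o) \in nested o q i.
Proof.
move=> lo iq; apply: (subsetP (nested_subset lo iq (leqnn _))).
exact: base_mem (nested_live lo (leqnn _)).
Qed.

(** [live_ex], started with all states of [N], provides a candidate; the run from [r] joins the
    output run of [h] at [a] and follows it there. *)
Lemma renew_live r q a : determined x0 h a -> in_state M a = q ->
  (exists w, runN r w = out_state x0 N h a) ->
  lv (scc p 0 q) (renew r q) /\ reaches r (renew r q).
Proof.
move=> da aq [w rw]; apply: (projT2 (boolp.choice renew_ex) (_, _)) => /=.
have aC : in_state M a \in scc p 0 q by rewrite aq scc_refl.
have [//|b [T [ab lT _]]] := @live_ex _ x0 M N h (scc p 0 q) a [set: N] da aC.
exists T; split; first by exists b.
have [v [_ rv _]] := @evolves_out_word _ x0 M N h _ a b da ab.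
have [db _ H] := lT; have [bT _] := H b (evolves_refl _ db).
by exists (out_state x0 N h b), (w ++ v); split=> //; rewrite run_cat rw.
Qed.

Lemma step_sound s x : sound s -> lv (scc p 0 (delta s.1 x)) (commit s x) /\
  reaches (position s) (commit s x).
Proof.
case: s => q [o|] /= H; rewrite /commit /=; last first.
  (* With no output letter claimed, the first input letter gives a determined configuration. *)
  apply: (@renew_live _ _ ([:: x], 0)); first by move=> xi _ i.
    by rewrite (H : q = start M).
  by exists [::].
have posT : position (q, Some o) \in o by exact: position_mem (leq0n _).
case: ifP => [qs|_].
  split; first by rewrite (scc_eq qs).
  by exists (position (q, Some o)), [::].
(* The component is left: inside it the input is first led to [q], where the output is still in [o]
   and hence reachable from the position; then [x] is read. *)
have [a [da aC aT]] := H.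
have [v [rv sv]] : exists v, runM (in_state M a) v = q /\
    staysM (scc p 0 q) (in_state M a) v.
  by rewrite -(scc_eq aC); apply: scc_path; rewrite (scc_eq aC) scc_refl.
have ab := evolves_input da sv.
apply: (@renew_live _ _ ((a.1 ++ v) ++ [:: x], a.2)).
- exact: determined_cat (evolves_determined ab) _.
- by rewrite /in_state !run_cat -/(in_state M a) rv.
have [bT _] := aT _ ab.
have [w [rw _]] := liveable_connected H posT bT.
exists w; rewrite rw.
by rewrite -(out_state_extends _ (evolves_determined ab) (@extends_pad _ x0 _ [:: x])).
Qed.

Lemma step_sound_next s x : sound s -> sound (step s x).
Proof. by move=> /step_sound-/(_ x)[]. Qed.

(** Recurrence makes the connecting words nonempty. This matters because [scanl] omits the initial
    state, even when [T] is a singleton. *)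
Lemma liveable_tour q T t0 : lv (scc p (p q) q) T -> recurrent p (p q) q -> t0 \in T ->
  exists w, [/\ runN t0 w = t0, staysN T t0 w & {subset T <= scanl (@delta _ N) t0 w}].
Proof.
move=> lT rec t0T.
have loop s t : s \in T -> t \in T ->
    exists w, [/\ 0 < size w, runN s w = t & staysN T s w].
  move=> sT tT; have [a la] := lT; have [da aC H] := la.
  have [_ /(_ s sT)[b [ab <-]]] := H a (evolves_refl _ da).
  have lb := live_evolves la ab; have [db bC _] := lb.
  have [c [bc lbc _ _]] := evolves_progress hcont db bC rec.
  have [cT _] := H c (evolves_trans ab bc).
  have [w [sw rw Hw]] := @evolves_out_word _ x0 M N h _ b c db bc.
  have [w' [rw' sw']] := liveable_connected lT cT tT.
  exists (w ++ w'); rewrite size_cat sw addn_gt0 subn_gt0 lbc run_cat rw stays_cat rw.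
  split=> //; rewrite sw' andbT; apply/allP => r /Hw[e [be <-]].
  by have [] := H e (evolves_trans ab be).
suff Hl (l : seq N) : {subset l <= T} -> exists w,
    [/\ runN t0 w = t0, staysN T t0 w & {subset l <= scanl (@delta _ N) t0 w}].
  have [|w [? ? sub]] := Hl (enum T); first by move=> t; rewrite mem_enum.
  by exists w; split=> // t tT; apply: sub; rewrite mem_enum.
elim: l => [|t l IH] lT'; first by exists [::].
have [|w [rw sw lw]] := IH; first by move=> s sl; apply: lT'; rewrite inE sl orbT.
have tT : t \in T by apply: lT'; rewrite inE eqxx.
have [u [u0 ru su]] := loop t0 t t0T tT.
have [v [v0 rv sv]] := loop t t0 tT t0T.
exists (w ++ u ++ v); rewrite !run_cat !stays_cat rw ru rv sw su sv; split=> // s.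
rewrite !scanl_cat !mem_cat -!/(run _ _ _) rw.
rewrite inE => /orP[/eqP ->|/lw -> //].
by rewrite -ru run_scanl ?orbT.
Qed.

Lemma output_ex (sx : memory * X) : exists w, sound sx.1 ->
  let q := delta sx.1.1 sx.2 in let T := nested (commit sx.1 sx.2) q in
  [/\ runN (position sx.1) w = position (step sx.1 sx.2),
      forall i, i <= p q -> position sx.1 \in T i -> staysN (T i) (position sx.1) w
    & recurrent p (p q) q -> {subset T (p q) <= scanl (@delta _ N) (position sx.1) w}].
Proof.
case: sx => s x /=; have [ss|nss] := EM (sound s); last by exists [::].
have [lo [t [w0 [tT rw0]]]] := step_sound x ss.
set o := commit s x in lo tT *; set q := delta s.1 x in lo *; set b := position s in rw0 *.
set b1 := position (step s x).
have b1T i : i <= p q -> b1 \in nested o q i by exact: position_mem.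
have [w [rw sw]] : exists w, runN b w = b1 /\
    forall i, i <= p q -> b \in nested o q i -> staysN (nested o q i) b w.
  have [ex|no] := EM (exists i, (i <= p q) && (b \in nested o q i)).
    (* The largest such level is the smallest set, so staying in it means staying in all the
       others. *)
    have [i /andP[ip bi] maxi] := ex_maxnP ex (fun i ipb => proj1 (andP ipb)).
    have [w [rw sw]] := liveable_connected (nested_live lo ip) bi (b1T i ip).
    exists w; split=> // j jp bj; apply: staysS sw.
    by apply: nested_subset => //; apply: maxi; rewrite jp.
  (* No level contains [b]: [w0] leads into [o], and no staying condition applies. *)
  have [w [rw _]] := liveable_connected lo tT (b1T 0 (leq0n _)).
  exists (w0 ++ w); rewrite run_cat rw0; split=> // i ip bi; case: no.
  by exists i; rewrite ip.
have [rec|nrec] := EM (recurrent p (p q) q); last by exists w.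
have [v [rv sv Tv]] := liveable_tour (nested_live lo (leqnn _)) rec (b1T _ (leqnn _)).
exists (w ++ v) => _; rewrite run_cat rw rv; split=> // [i ip bi|_ r rT].
  rewrite stays_cat sw // rw; apply: staysS sv.
  exact: nested_subset.
by rewrite scanl_cat mem_cat -/(run _ _ _) rw Tv ?orbT.
Qed.
Definition output s x := projT1 (boolp.choice output_ex) (s, x).

Lemma outputP s x : sound s ->
  let q := delta s.1 x in let T := nested (commit s x) q in
  [/\ runN (position s) (output s x) = position (step s x),
      forall i, i <= p q -> position s \in T i -> staysN (T i) (position s) (output s x)
    & recurrent p (p q) q ->
      {subset T (p q) <= scanl (@delta _ N) (position s) (output s x)}].
Proof. exact: (projT2 (boolp.choice output_ex) (s, x)). Qed.

(* Along a loop of [M] the commitment is never revised. *)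
Lemma step_aperiodic : aperiodic (@delta _ M) -> aperiodic step.
Proof.
move=> apM [q o] u n u0 n0 run_n.
have run1 v s : (run step s v).1 = runM s.1 v by elim: v s => //= x v IH s; rewrite IH.
have rq : runM q u = q.
  apply: (apM q u n) => //.
  by have -> : q = (q, o).1 by []; rewrite -run1 run_n.
have run_some v s : 0 < size v -> exists o', (run step s v).2 = Some o'.
  elim: v s => // x [|y v] IH s _ /=; first by exists (commit s x).
  exact: IH.
(* Any nonempty run ends with a commitment, so a memory returning to itself has one. *)
have [o' oE] : exists o', o = Some o'.
  have [|o' E] := run_some (flatten (nseq n u)) (q, o); last by exists o'; rewrite -E run_n.
  by case: (n) n0 => // m _; rewrite /= size_cat addn_gt0 u0.
rewrite oE in run_n *; clear run_n oE.
have edgeM r x : edge p 0 r (delta r x) by apply/existsP; exists x.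
have connM v r : connect (edge p 0) r (runM r v).
  elim: v r => [|x v IH] r; first exact: connect0.
  exact: connect_trans (connect1 (edgeM r x)) (IH _).
(* The loop is weakened to a path whose end leads back to [r], a property that the tail of [v]
   inherits. *)
suff H v r : connect (edge p 0) (runM r v) r ->
    run step (r, Some o') v = (runM r v, Some o') by rewrite H rq.
elim: v r => //= x v IH r rv.
have dr : delta r x \in scc p 0 r.
  by rewrite inE connect1 ?edgeM //=; apply: connect_trans rv; apply: connM.
rewrite /step /commit /= dr; apply: IH.
exact: connect_trans rv (connect1 (edgeM r x)).
Qed.

(** * Correctness of the transducer *)

Notation memory_at xi n := (state step (start M, None) xi n).

Lemma memory_trace xi n : (memory_at xi n).1 = trace M xi n.
Proof. by elim: n => // n IH; rewrite [trace M xi n.+1]stateS stateS /= IH. Qed.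

Lemma memory_sound xi n : sound (memory_at xi n).
Proof. by elim: n => // n IH; rewrite stateS; apply: step_sound_next. Qed.

Notation outputs xi n := (trans_out step output (start M, None) xi n).

Lemma run_outputs xi n : runN (start N) (outputs xi n) = position (memory_at xi n).
Proof.
elim: n => // n IH; rewrite trans_outS run_cat IH stateS.
by have [] := outputP (xi n) (memory_sound xi n).
Qed.

(* On every input the transducer eventually tours one set [T], namely the one
   attached to the component of [q], a recurring state of minimal rank. *)
Lemma eventual_tour xi : exists q T n0,
  [/\ visited_io M xi q /\ (forall r, visited_io M xi r -> p q <= p r),
      lv (scc p (p q) q) T, recurrent p (p q) q,
      forall n, n0 <= n -> staysN T (position (memory_at xi n))
        (output (memory_at xi n) (xi n)) &
      io (fun n => {subset T <= scanl (@delta _ N) (position (memory_at xi n))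
        (output (memory_at xi n) (xi n))})].
Proof.
have [t Ht] := eventually_io (trace M xi).
have [q ioq minq] : exists2 q, visited_io M xi q & forall r, visited_io M xi r -> p q <= p r.
  pose V := [pred q | `[< visited_io M xi q >]].
  have V0 : V (trace M xi t) by apply/asboolP; apply: Ht.
  case: (arg_minnP p V0) => q /asboolP ioq minq; exists q => // r ior.
  by apply: minq; apply/asboolP.
have rank n : t <= n -> p q <= p (trace M xi n) by move=> /Ht/minq.
have conn n m : t <= n -> t <= m -> connect (edge p (p q)) (trace M xi n) (trace M xi m).
  move=> tn tm; have [k [nk <-]] := Ht m tm n.
  apply: connect_trace => // j nj _; apply: rank; exact: leq_trans nj.
have inscc n m : t <= n -> t <= m -> trace M xi m \in scc p (p q) (trace M xi n).
  by move=> tn tm; rewrite inE !conn.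
(* From time [t] on the run stays in one component, so [commit] no longer renews; the memory is sure
   to hold the final set only after step [t]. *)
have [o Ho] : exists o, forall n, t < n -> (memory_at xi n).2 = Some o.
  exists (commit (memory_at xi t) (xi t)) => n /subnKC <-.
  elim: (n - t.+1) => [|k IH]; first by rewrite addn0 stateS.
  rewrite addnS stateS /= /commit IH memory_trace ifT //.
  have tk : t <= t.+1 + k by rewrite addSn ltnW // ltnS leq_addr.
  have := inscc (t.+1 + k) (t.+1 + k).+1 tk (leqW tk).
  rewrite [trace M xi (t.+1 + k).+1]stateS; apply/subsetP.
  exact: scc_subset.
have memE n : t < n -> memory_at xi n = (trace M xi n, Some o).
  by move=> tn; rewrite -memory_trace -(Ho n tn); case: (memory_at xi n).
have [n1 [tn1 qn1]] := ioq t.+1.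
have soundn n : t < n -> lv (scc p 0 (trace M xi n)) o.
  by move=> tn; have := memory_sound xi n; rewrite memE.
have qscc n : t < n -> trace M xi n \in scc p (p q) q.
  by move=> tn; rewrite -{2}qn1; apply: inscc; apply: ltnW.
have TE n i : t < n -> i <= p q -> nested o (trace M xi n) i = nested o q i.
  by move=> tn iq; apply/esym/(nested_scc _ _ iq); apply: qscc.
have loq : lv (scc p 0 q) o by have := soundn n1 tn1; rewrite [trace _ _ _]qn1.
have stepE n : t < n -> commit (memory_at xi n) (xi n) = o /\
    delta (memory_at xi n).1 (xi n) = trace M xi n.+1.
  move=> tn; have := memE n.+1 (ltnW tn); rewrite stateS /step => -[-> ->].
  by [].
have rec : recurrent p (p q) q.
  have [n2 [n12 qn2]] := ioq n1.+1.
  exists (mkseq (fun i => xi (n1 + i)) (n2 - n1)).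
  have runE k : runM q (mkseq (fun i => xi (n1 + i)) k) = trace M xi (n1 + k).
    elim: k => [|k IH]; first by rewrite addn0 -qn1.
    by rewrite mkseqS /run foldl_rcons -/(run _ _ _) IH addnS [RHS]stateS.
  split; first by rewrite size_mkseq subn_gt0.
    by rewrite runE subnKC ?(ltnW n12).
  apply/allP => r /mem_scanl[j [_ jk <-]].
  rewrite size_mkseq in jk.
  have -> : take j (mkseq (fun i => xi (n1 + i)) (n2 - n1)) = mkseq (fun i => xi (n1 + i)) j.
    by rewrite /mkseq -map_take take_iota (minn_idPl jk).
  by rewrite runE; apply: qscc; apply: leq_trans (leq_addr _ _).
exists q, (nested o q (p q)), t.+1; split=> //.
- exact: nested_live.
- move=> n tn; have [cE dE] := stepE n tn.
  have [_ H _] := outputP (xi n) (memory_sound xi n).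
  move: H => /(_ (p q)); rewrite cE dE TE ?ltnS ?(ltnW tn) //; apply.
    by apply: rank; rewrite ltnW // ltnW.
  by rewrite memE // -(TE n) //; apply: position_mem; [apply: soundn | apply/rank/ltnW].
(* The tour is written at step [m], on entering [q] at time [m.+1]; hence the extra offset. *)
move=> n; have [[|m] [nm qm]] := ioq (maxn n t).+2; first by rewrite ltn0 in nm.
have [nm' tm] : n <= m /\ t < m.
  by split; [apply: ltnW|]; apply: leq_ltn_trans (nm : maxn n t < m); rewrite leq_max leqnn ?orbT.
exists m; split=> //; have [cE dE] := stepE m tm.
have [_ _] := outputP (xi m) (memory_sound xi m).
by rewrite cE dE [trace M xi m.+1]qm; apply.
Qed.

Lemma outputs_chain xi n : exists w, outputs xi n.+1 = outputs xi n ++ w.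
Proof. by eexists; rewrite trans_outS. Qed.

Lemma size_outputs xi n m : n <= m -> size (outputs xi n) <= size (outputs xi m).
Proof.
by move=> /(chain_cat (outputs_chain xi))[w ->]; rewrite size_cat leq_addr.
Qed.

(** Every tour of the inhabited set [T] writes at least one letter. *)
Lemma outputs_infinite xi m : exists n, m < size (outputs xi n).
Proof.
have [q [T [n0 [_ lT _ _ tour]]]] := eventual_tour xi.
have [t tT] := liveable_inhabited lT.
have progress n : exists k, size (outputs xi n) < size (outputs xi k).
  have [k [nk /(_ t tT) tk]] := tour n; exists k.+1; rewrite trans_outS size_cat.
  apply: leq_ltn_trans (size_outputs xi nk) _; rewrite -[X in X < _]addn0 ltn_add2l.
  by case: (output _ _) tk.
elim: m => [|m [n mn]]; first by have [k ?] := progress 0; exists k.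
by have [k ?] := progress n; exists k; apply: leq_ltn_trans mn _.
Qed.

Lemma state_outputs xi eta n j : extends x0 eta (outputs xi n.+1) ->
  j <= size (output (memory_at xi n) (xi n)) ->
  state (@delta _ N) (start N) eta (size (outputs xi n) + j) =
    runN (position (memory_at xi n)) (take j (output (memory_at xi n) (xi n))).
Proof.
rewrite trans_outS; set w := output _ _ => ext jw.
have {}ext : extends x0 eta (outputs xi n ++ take j w).
  by apply: (@extends_cat _ _ _ _ (drop j w)); rewrite -catA cat_take_drop.
have -> : size (outputs xi n) + j = size (outputs xi n ++ take j w).
  by rewrite size_cat size_takel.
by rewrite (state_extends _ _ ext) run_cat run_outputs.
Qed.

(** [xi'] is the play of [live_play] for the toured set [T], which is the infinity set of both
    output runs. *)
Lemma outputs_inf xi eta : (forall n, extends x0 eta (outputs xi n)) ->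
  exists xi', [/\ exists q, [/\ visited_io M xi q, visited_io M xi' q,
      forall r, visited_io M xi r -> p q <= p r & forall r, visited_io M xi' r -> p q <= p r]
    & same_inf N eta (h xi')].
Proof.
move=> ext; have [q [T [n0 [[ioq minq] lT rec inT tour]]]] := eventual_tour xi.
have [xi' [ioq' minq' infT]] := live_play hcont lT rec.
exists xi'; split; first by exists q.
move=> t; rewrite infT; split=> [iot|tT n].
  have [i [n0i <-]] := iot (size (outputs xi n0)).+1.
  have [m im] := outputs_infinite xi i.
  (* The least such [k] places position [i] in the word written at step [k.-1]; the strict bound on
     [i] puts that step at or after [n0]. *)
  have ex : exists k, i <= size (outputs xi k) by exists m; apply: ltnW.
  have [k ik mink] := ex_minnP ex.
  have n0k : n0 < k.
    by rewrite ltnNge; apply/negP => /(size_outputs xi)/(leq_trans ik); rewrite leqNgt n0i.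
  case: k ik mink n0k => // k ik mink n0k.
  have ki : size (outputs xi k) < i.
    by rewrite ltnNge; apply/negP => /mink; rewrite ltnn.
  move: (ik); rewrite trans_outS size_cat -leq_subLR => jw.
  rewrite -[in state _ _ _ i](subnKC (ltnW ki)) (state_outputs (ext _) jw).
  by apply: (allP (inT k _)) => //; apply: run_take_scanl; rewrite // subn_gt0.
have [m nm] := outputs_infinite xi n.
have [k [mk /(_ t tT)/mem_scanl[j [_ jw <-]]]] := tour m.
exists (size (outputs xi k) + j); split; last exact: state_outputs.
apply: leq_trans (leq_addr _ _); apply: leq_trans (ltnW nm) _.
exact: size_outputs.
Qed.

End Strategy.

(** * From continuous reductions to transducers *)

Lemma le_CA_transducer (X : finType) (x0 : X) ap k (A B : kpartition X k)
    (M N : automaton X) : aper ap M ->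
  (forall xi xi', same_inf M xi xi' -> A xi = A xi') ->
  (forall eta eta', same_inf N eta eta' -> B eta = B eta') ->
  le_CA A B ->
  exists (Q : finType) (f : Q -> X -> Q) (g : Q -> X -> seq X) (q0 : Q) h,
    [/\ ap -> aperiodic f, computes f g q0 h & forall xi, A xi = B (h xi)].
Proof.
move=> apM detA detB [h [hcont AB]].
have [{detA apM}M [p [apM detA]]] := min_rank_automaton apM detA.
have [h' [comp ext]] := trans_out_computes x0 (outputs_infinite x0 N p hcont).
do 5 eexists; split; last first.
(* [A xi = A xi'] by the shared recurring state of minimal rank, [A xi' = B (h xi')] by the given
   reduction, and [B (h xi') = B (h' xi)] by equal infinity sets. *)
- move=> xi; have [xi' [[q [? ? ? ?]] same]] := outputs_inf (ext xi).
  by rewrite (detA xi xi' q) // AB; apply/esym/detB.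
- exact: comp.
by move=> /apM; apply: step_aperiodic.
Qed.

Lemma in_Rk_automaton (X : finType) k (A : kpartition X k) : in_Rk A ->
  exists M : automaton X, forall xi xi', same_inf M xi xi' -> A xi = A xi'.
Proof.
move=> HA; have [|M [_ ?]] := @partition_automaton X False k A; last by exists M.
by move=> i; have [Q [f [q0 [F H]]]] := HA i; exists Q, f, q0, F.
Qed.

Lemma in_Ak_automaton (X : finType) k (A : kpartition X k) : in_Ak A ->
  exists M : automaton X, aper True M /\ forall xi xi', same_inf M xi xi' -> A xi = A xi'.
Proof.
move=> HA; apply: partition_automaton => i.
by have [Q [f [q0 [F [? H]]]]] := HA i; exists Q, f, q0, F.
Qed.

Theorem theorem4p13 (X : finType) (hX : 2 <= #|X|) (k : nat) (hk : 2 <= k) :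
  (forall A B : kpartition X k, in_Rk A -> in_Rk B -> (le_CA A B <-> le_DA A B)) /\
  (forall A B : kpartition X k, in_Ak A -> in_Ak B -> (le_CA A B <-> le_AA A B)).
Proof.
have /card_gt0P[x0 _] : 0 < #|X| by apply: ltn_trans hX.
split=> A B HA HB.
  have [M detA] := in_Rk_automaton HA; have [N detB] := in_Rk_automaton HB.
  split=> [AB|[h [[Q [f [g [q0 comp]]]] AB]]].
    have apM : aper False M by [].
    have [Q [f [g [q0 [h [_ comp AhB]]]]]] := le_CA_transducer x0 apM detA detB AB.
    by exists h; split=> //; exists Q, f, g, q0.
  by exists h; split=> //; apply: computes_continuous comp.
have [M [apM detA]] := in_Ak_automaton HA; have [N [_ detB]] := in_Ak_automaton HB.
split=> [AB|[h [[Q [f [g [q0 [_ comp]]]]] AB]]].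
  have [Q [f [g [q0 [h [apf comp AhB]]]]]] := le_CA_transducer x0 apM detA detB AB.
  by exists h; split=> //; exists Q, f, g, q0; split=> //; apply: apf.
by exists h; split=> //; apply: computes_continuous comp.
Qed.
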